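(* Let $v,w$, $a,b,c$, $B,C$ be as in the context, and suppose $\xi:=cC+ibB\neq0$. Define $\chi_k:\mathbb{C}\to(0,\infty)$, where $\mathbb{C}=\mathbb{R}^2$ has coordinate $s+it$, by $$\chi_{3k-1}=|\xi|^{2/3}(a+bv+cw)^{-1},\quad \chi_{3k}=1,\quad \chi_{3k+1}=|\xi|^{-2/3}(a+bv+cw)\quad\text{for all }k\in\mathbb{Z}.$$ Then the $\chi_k$ satisfy the Toda lattice equations for $\mathrm{SU}(3)$ with respect to the coordinate $z'=\xi^{1/3}(s+it)$, for a fixed cube root $\xi^{1/3}$ of $\xi$. In terms of $s,t$, this means that $\chi_0\chi_1\chi_2\equiv1$, $\chi_{k+3}=\chi_k$ and $$\frac{1}{4|\xi|^{2/3}}\left(\frac{\partial^2}{\partial s^2}+\frac{\partial^2}{\partial t^2}\right)\bigl(\log\chi_k\bigr)=\chi_{k+1}\chi_k^{-1}-\chi_k\chi_{k-1}^{-1}\quad\text{for all }k\in\mathbb{Z}.$$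
   Context: Setting. Fix $\theta_0\in[0,2\pi)$ and set $\beta_1=\frac1{\sqrt2}\cos\theta_0-\frac1{\sqrt6}\sin\theta_0$, $\beta_2=-\frac1{\sqrt2}\cos\theta_0-\frac1{\sqrt6}\sin\theta_0$, $\beta_3=\frac2{\sqrt6}\sin\theta_0$, $\gamma_1=-\frac1{\sqrt6}\cos\theta_0-\frac1{\sqrt2}\sin\theta_0$, $\gamma_2=-\frac1{\sqrt6}\cos\theta_0+\frac1{\sqrt2}\sin\theta_0$, $\gamma_3=\frac2{\sqrt6}\cos\theta_0$. Let $y_1,y_2,y_3:\mathbb{R}\to\mathbb{C}$, $v:\mathbb{R}\to\mathbb{R}$ (functions of $s$) and $z_1,z_2,z_3:\mathbb{R}\to\mathbb{C}$, $w:\mathbb{R}\to\mathbb{R}$ (functions of $t$) satisfy, for all $s,t$: $\frac{dy_1}{ds}=\beta_1\overline{y_2y_3}$, $\frac{dy_2}{ds}=\beta_2\overline{y_3y_1}$, $\frac{dy_3}{ds}=\beta_3\overline{y_1y_2}$, $|y_j|^2=\beta_jv+1$; $\frac{dz_1}{dt}=\gamma_1\overline{z_2z_3}$, $\frac{dz_2}{dt}=\gamma_2\overline{z_3z_1}$, $\frac{dz_3}{dt}=\gamma_3\overline{z_1z_2}$, $|z_j|^2=\gamma_jw+1$. Then $\operatorname{Im}(y_1y_2y_3)\equiv B$ and $\operatorname{Im}(z_1z_2z_3)\equiv C$ for constants $B,C\in[-1,1]$. Set $a=\frac16$, $b=-\frac12\beta_1\beta_2\beta_3$, $c=-\frac12\gamma_1\gamma_2\gamma_3$.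 The Toda lattice equations for $\mathrm{SU}(m)$, for functions $\chi_k:\mathbb{C}\to(0,\infty)$, $k\in\mathbb{Z}$, with respect to a holomorphic coordinate $z$, are: $\chi_{k+m}=\chi_k$ for all $k$, $\chi_0\chi_1\cdots\chi_{m-1}\equiv1$, and $\frac{\partial^2}{\partial z\partial\bar z}(\log\chi_k)=\chi_{k+1}\chi_k^{-1}-\chi_k\chi_{k-1}^{-1}$ for all $k\in\mathbb{Z}$. *)

(* Defs.v *)
From Stdlib Require Export Reals ZArith List.
From Coquelicot Require Export Coquelicot.
Open Scope R_scope.

Definition beta1 (theta : R) : R := 1 / sqrt 2 * cos theta - 1 / sqrt 6 * sin theta.
Definition beta2 (theta : R) : R := - (1 / sqrt 2) * cos theta - 1 / sqrt 6 * sin theta.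
Definition beta3 (theta : R) : R := 2 / sqrt 6 * sin theta.

Definition gamma1 (theta : R) : R := - (1 / sqrt 6) * cos theta - 1 / sqrt 2 * sin theta.
Definition gamma2 (theta : R) : R := - (1 / sqrt 6) * cos theta + 1 / sqrt 2 * sin theta.
Definition gamma3 (theta : R) : R := 2 / sqrt 6 * cos theta.

(* [C] is viewed as a real normed module: derivative of a curve R -> C. *)
Definition is_derive_RC (f : R -> C) (x : R) (l : C) : Prop :=
  @is_derive R_AbsRing C_R_NormedModule f x l.

(* The system solved by (y, v) with coefficients beta, and by (z, w) with
   coefficients gamma. *)
Definition triple_system (l1 l2 l3 : R) (u1 u2 u3 : R -> C) (q : R -> R) : Prop :=
  forall x : R,
    is_derive_RC u1 x (RtoC l1 * Cconj (u2 x * u3 x))%C /\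
    is_derive_RC u2 x (RtoC l2 * Cconj (u3 x * u1 x))%C /\
    is_derive_RC u3 x (RtoC l3 * Cconj (u1 x * u2 x))%C /\
    Cmod (u1 x) ^ 2 = l1 * q x + 1 /\
    Cmod (u2 x) ^ 2 = l2 * q x + 1 /\
    Cmod (u3 x) ^ 2 = l3 * q x + 1.

Definition is_partial_re (F : C -> C) (p l : C) : Prop :=
  is_derive_RC (fun x : R => F (x, Im p)) (Re p) l.
Definition is_partial_im (F : C -> C) (p l : C) : Prop :=
  is_derive_RC (fun y : R => F (Re p, y)) (Im p) l.

(* Wirtinger operators d/dz = (d/dx - i d/dy)/2 and
   d/dzbar = (d/dx + i d/dy)/2, as relations, so that the existence of the
   partial derivatives is part of the assertion. *)
Definition is_wirtinger (F : C -> C) (p l : C) : Prop :=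
  exists lx ly : C, is_partial_re F p lx /\ is_partial_im F p ly /\
    l = ((lx - Ci * ly) / RtoC 2)%C.
Definition is_wirtinger_bar (F : C -> C) (p l : C) : Prop :=
  exists lx ly : C, is_partial_re F p lx /\ is_partial_im F p ly /\
    l = ((lx + Ci * ly) / RtoC 2)%C.

(* d^2 F / dz dzbar = L on all of C. *)
Definition is_wirtinger_mixed (F : C -> C) (L : C -> C) : Prop :=
  exists G : C -> C, forall p : C, is_wirtinger_bar F p (G p) /\ is_wirtinger G p (L p).

(* The Toda lattice equations for SU(m) with respect to the standard
   coordinate of C. *)
Definition toda_lattice (m : nat) (chi : Z -> C -> R) : Prop :=
  (forall (k : Z) (p : C), 0 < chi k p) /\
  (forall (k : Z) (p : C), chi (k + Z.of_nat m)%Z p = chi k p) /\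
  (forall p : C,
     fold_right Rmult 1 (map (fun k : nat => chi (Z.of_nat k) p) (seq 0 m)) = 1) /\
  (forall k : Z,
     is_wirtinger_mixed (fun p => RtoC (ln (chi k p)))
       (fun p => RtoC (chi (k + 1)%Z p * / chi k p - chi k p * / chi (k - 1)%Z p))).

(* The same equations with respect to a holomorphic coordinate phi on C: the
   functions are expressed through the inverse psi of phi.  An injective entire
   function is affine, so asking phi to be onto C excludes no coordinate. *)
Definition toda_lattice_wrt (phi : C -> C) (m : nat) (chi : Z -> C -> R) : Prop :=
  (forall p : C, @ex_derive C_AbsRing (AbsRing_NormedModule C_AbsRing) phi p) /\
  exists psi : C -> C,
    (forall p : C, psi (phi p) = p) /\ (forall p : C, phi (psi p) = p) /\
    toda_lattice m (fun k p => chi k (psi p)).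

(* [Derive] is a total operator, hence this side condition next to [Derive_n _ 2]. *)
Definition twice_derivable (f : R -> R) : Prop :=
  forall x : R, ex_derive f x /\ ex_derive (Derive f) x.

(* Main.v *)
Require Import Defs.
From Stdlib Require Import Reals ZArith List Lra Lia.
From Coquelicot Require Import Coquelicot.
Open Scope R_scope.

(** Write [f = a + b v(s) + c w(t)] and [rho = |xi|^(2/3)].  Every [log chi_k] is
    [e (log f - log rho)] with [e] in [{0, 1, -1}], and the right-hand side of the Toda
    equation is [e (rho^2 / f^2 - f / rho)].  So everything reduces to the positivity of
    [f] and to the Liouville-type equation
    [Delta (log f) = 4 |xi|^2 / f^2 - 4 f].

    The coefficients satisfy [sum beta_j = 0], [sum beta_j^2 = 1], likewise for
    [gamma_j], and [b^2 + c^2 = 1/216].  Differentiating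
    [v = sum beta_j |y_j|^2] gives [v' = 2 Re (y1 y2 y3)] and [v'' = - 2 v - 12 b v^2],
    while [|y1 y2 y3|^2 = Re^2 + Im^2] gives
    [v'^2 = 4 (prod (beta_j v + 1) - B^2)] ([triple_system_ode]).  The same holds for
    [w].  Substituting these in [f Delta f - |grad f|^2] leaves the polynomial identity
    [liouville_identity], which yields the equation because
    [|xi|^2 = b^2 B^2 + c^2 C^2].

    Positivity ([affine_potential_pos]) follows from the same identity, now read at
    arbitrary points of the plane [(v, w)]: [f] cannot vanish where
    [b^2 prod (beta_j v + 1) + c^2 prod (gamma_j w + 1) > 0].  This holds at every
    value [(v(s), w(t))], since there the sum is at least [|xi|^2], and on the
    half-open segment from the origin to that value.  As [f] is affine in [(v, w)] and
    equals [1/6] at the origin, it is positive at [(v(s), w(t))].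

    For the coordinate [zeta (s + i t)] with [zeta^3 = xi], a complex-linear change of
    variable multiplies [d^2/dz dzbar = Delta / 4] by [|1/zeta|^2 = 1 / rho]
    ([is_wirtinger_mixed_rotated]). *)

(** * Derivatives of real functions and of curves in the complex plane *)

(** The eta-expanded form is the one in which [auto_derive] leaves derivatives. *)
Lemma Derive_app (f : R -> R) (x l : R) : is_derive f x l -> Derive (fun t => f t) x = l.
Proof. apply is_derive_unique. Qed.

Lemma is_derive_RC_pair (f g : R -> R) (x lf lg : R) :
  is_derive f x lf -> is_derive g x lg ->
  is_derive_RC (fun x => (f x, g x)) x (lf, lg).
Proof.
intros Hf Hg. unfold is_derive_RC.
pose (e1 := (1, 0) : C_R_NormedModule).
pose (e2 := (0, 1) : C_R_NormedModule).
assert (He : forall r s : R, plus (scal r e1) (scal s e2) = ((r, s) : C_R_NormedModule)).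
{ intros r s. unfold e1, e2, plus, scal; simpl.
  unfold prod_plus, prod_scal, plus, scal; simpl. unfold mult; simpl.
  apply f_equal2; ring. }
rewrite <- (He lf lg).
apply is_derive_ext with (fun t => plus (scal (f t) e1) (scal (g t) e2)).
- intros t. apply He.
- apply (is_derive_plus (K := R_AbsRing) (V := C_R_NormedModule));
    apply (is_derive_scal_l (K := R_AbsRing) (V := C_R_NormedModule)); assumption.
Qed.

Lemma is_derive_RC_Re (f : R -> C) (x : R) (l : C) :
  is_derive_RC f x l -> is_derive (fun x => Re (f x)) x (Re l).
Proof.
intros H.
apply (filterdiff_comp' (K := R_AbsRing) (V := C_R_NormedModule) (W := R_NormedModule)
  f (fun p : C => Re p) x (fun y => scal y l) (fun p : C => Re p) H).
apply (filterdiff_linear (U := prod_NormedModule R_AbsRing R_NormedModule R_NormedModule)).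
apply is_linear_fst.
Qed.

Lemma is_derive_RC_Im (f : R -> C) (x : R) (l : C) :
  is_derive_RC f x l -> is_derive (fun x => Im (f x)) x (Im l).
Proof.
intros H.
apply (filterdiff_comp' (K := R_AbsRing) (V := C_R_NormedModule) (W := R_NormedModule)
  f (fun p : C => Im p) x (fun y => scal y l) (fun p : C => Im p) H).
apply (filterdiff_linear (U := prod_NormedModule R_AbsRing R_NormedModule R_NormedModule)).
apply is_linear_snd.
Qed.

(** * The second-order equation solved by v and w *)

(** With [u_j = a_j + i b_j], the hypotheses are the real and imaginary parts of
    [u_1' = l1 conj (u_2 u_3)] and its cyclic permutations, and [ReY] is the real part
    of [u_1 u_2 u_3]. *)
Lemma triple_system_derivatives (a1 b1 a2 b2 a3 b3 : R -> R) (l1 l2 l3 x : R) :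
  is_derive a1 x (l1 * (a2 x * a3 x - b2 x * b3 x)) ->
  is_derive b1 x (- l1 * (a2 x * b3 x + b2 x * a3 x)) ->
  is_derive a2 x (l2 * (a3 x * a1 x - b3 x * b1 x)) ->
  is_derive b2 x (- l2 * (a3 x * b1 x + b3 x * a1 x)) ->
  is_derive a3 x (l3 * (a1 x * a2 x - b1 x * b2 x)) ->
  is_derive b3 x (- l3 * (a1 x * b2 x + b1 x * a2 x)) ->
  let ReY t := (a1 t * a2 t - b1 t * b2 t) * a3 t - (a1 t * b2 t + b1 t * a2 t) * b3 t in
  let N1 := a1 x ^ 2 + b1 x ^ 2 in
  let N2 := a2 x ^ 2 + b2 x ^ 2 in
  let N3 := a3 x ^ 2 + b3 x ^ 2 in
  is_derive (fun t => l1 * (a1 t ^ 2 + b1 t ^ 2) + l2 * (a2 t ^ 2 + b2 t ^ 2)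
    + l3 * (a3 t ^ 2 + b3 t ^ 2)) x (2 * (l1 ^ 2 + l2 ^ 2 + l3 ^ 2) * ReY x) /\
  is_derive ReY x (l1 * (N2 * N3) + l2 * (N3 * N1) + l3 * (N1 * N2)).
Proof.
intros A1 B1 A2 B2 A3 B3 ReY N1 N2 N3. unfold ReY, N1, N2, N3.
split; auto_derive.
1, 3: repeat split; eexists; eassumption.
all: rewrite (Derive_app _ _ _ A1), (Derive_app _ _ _ B1), (Derive_app _ _ _ A2),
  (Derive_app _ _ _ B2), (Derive_app _ _ _ A3), (Derive_app _ _ _ B3); ring.
Qed.

(** The system determines [q] through the conserved quantities [|u_j|^2 - l_j q = 1]:
    [q = sum l_j |u_j|^2], hence [q' = 2 Re (u_1 u_2 u_3)]. *)
Lemma triple_system_ode (l1 l2 l3 : R) (u1 u2 u3 : R -> C) (q : R -> R) (K : R) :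
  l1 + l2 + l3 = 0 -> l1 ^ 2 + l2 ^ 2 + l3 ^ 2 = 1 ->
  triple_system l1 l2 l3 u1 u2 u3 q ->
  (forall x, Im (u1 x * u2 x * u3 x)%C = K) ->
  exists q1 : R -> R, forall x,
    is_derive q x (q1 x) /\
    is_derive q1 x (- 2 * q x + 6 * (l1 * l2 * l3) * q x ^ 2) /\
    q1 x ^ 2 = 4 * ((l1 * q x + 1) * (l2 * q x + 1) * (l3 * q x + 1) - K ^ 2).
Proof.
intros Hsum Hsq Hsys HK.
pose (Y x := (u1 x * u2 x * u3 x)%C).
exists (fun x => 2 * Re (Y x)). intros x.
assert (Hq : forall t, l1 * (Re (u1 t) ^ 2 + Im (u1 t) ^ 2) +
    l2 * (Re (u2 t) ^ 2 + Im (u2 t) ^ 2) + l3 * (Re (u3 t) ^ 2 + Im (u3 t) ^ 2) = q t).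
{ intros t. destruct (Hsys t) as (_ & _ & _ & N1 & N2 & N3).
  rewrite Cmod2_alt in N1, N2, N3. rewrite N1, N2, N3.
  transitivity ((l1 ^ 2 + l2 ^ 2 + l3 ^ 2) * q t + (l1 + l2 + l3)); [ring|].
  rewrite Hsum, Hsq. ring. }
destruct (Hsys x) as (D1 & D2 & D3 & N1 & N2 & N3).
rewrite Cmod2_alt in N1, N2, N3.
assert (Hs2 : l1 * l2 + l2 * l3 + l3 * l1 = - (1 / 2)).
{ assert (Z : (l1 + l2 + l3) ^ 2 = 0) by (rewrite Hsum; ring).
  replace ((l1 + l2 + l3) ^ 2) with
    (l1 ^ 2 + l2 ^ 2 + l3 ^ 2 + 2 * (l1 * l2 + l2 * l3 + l3 * l1)) in Z by ring.
  rewrite Hsq in Z. lra. }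
assert (HYn : Re (Y x) ^ 2 + Im (Y x) ^ 2 =
   (l1 * q x + 1) * (l2 * q x + 1) * (l3 * q x + 1)).
{ rewrite <- N1, <- N2, <- N3. unfold Y.
  destruct (u1 x), (u2 x), (u3 x); simpl. ring. }
assert (Hre : forall (l : R) (a b : C),
    Re (l * Cconj (a * b))%C = l * (Re a * Re b - Im a * Im b))
  by (intros l [a a1] [b b1]; simpl; ring).
assert (Him : forall (l : R) (a b : C),
    Im (l * Cconj (a * b))%C = - l * (Re a * Im b + Im a * Re b))
  by (intros l [a a1] [b b1]; simpl; ring).
assert (R1 := is_derive_RC_Re _ _ _ D1). assert (I1 := is_derive_RC_Im _ _ _ D1).
assert (R2 := is_derive_RC_Re _ _ _ D2). assert (I2 := is_derive_RC_Im _ _ _ D2).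
assert (R3 := is_derive_RC_Re _ _ _ D3). assert (I3 := is_derive_RC_Im _ _ _ D3).
rewrite Hre in R1, R2, R3. rewrite Him in I1, I2, I3.
destruct (triple_system_derivatives _ _ _ _ _ _ _ _ _ _ R1 I1 R2 I2 R3 I3) as [Dq DY].
cbv beta in DY. rewrite N1, N2, N3 in DY.
split; [|split].
- apply is_derive_ext with (1 := Hq).
  replace (2 * Re (Y x)) with (2 * (l1 ^ 2 + l2 ^ 2 + l3 ^ 2) * Re (Y x))
    by (rewrite Hsq; ring).
  exact Dq.
- replace (- 2 * q x + 6 * (l1 * l2 * l3) * q x ^ 2) with
    (2 * (l1 * ((l2 * q x + 1) * (l3 * q x + 1)) + l2 * ((l3 * q x + 1) * (l1 * q x + 1))
      + l3 * ((l1 * q x + 1) * (l2 * q x + 1)))).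
  + apply (is_derive_scal (fun t => Re (Y t)) x 2). exact DY.
  + transitivity (2 * ((l1 + l2 + l3) + 2 * (l1 * l2 + l2 * l3 + l3 * l1) * q x
         + 3 * (l1 * l2 * l3) * q x ^ 2)); [ring|].
    rewrite Hsum, Hs2. field.
- rewrite <- HYn. assert (HYx := HK x). fold (Y x) in HYx. rewrite HYx. ring.
Qed.

(** * The coefficients beta and gamma *)

Lemma inv_sqrt_sqr (x : R) : 0 < x -> (1 / sqrt x) ^ 2 = / x.
Proof.
intros Hx. rewrite <- (pow2_sqrt x) at 2 by lra. field.
apply Rgt_not_eq, sqrt_lt_R0, Hx.
Qed.

Lemma inv_sqrt_2_6 : 1 / sqrt 6 * (1 / sqrt 6) = 1 / 6 /\ 1 / sqrt 2 * (1 / sqrt 2) = 1 / 2.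
Proof.
split.
- assert (H := inv_sqrt_sqr 6 ltac:(lra)). simpl in H. lra.
- assert (H := inv_sqrt_sqr 2 ltac:(lra)). simpl in H. lra.
Qed.

Lemma coeff_sum (theta : R) :
  beta1 theta + beta2 theta + beta3 theta = 0 /\
  gamma1 theta + gamma2 theta + gamma3 theta = 0.
Proof.
unfold beta1, beta2, beta3, gamma1, gamma2, gamma3, Rdiv. split; ring.
Qed.

Lemma coeff_sum_sqr (theta : R) :
  beta1 theta ^ 2 + beta2 theta ^ 2 + beta3 theta ^ 2 = 1 /\
  gamma1 theta ^ 2 + gamma2 theta ^ 2 + gamma3 theta ^ 2 = 1.
Proof.
assert (Hcs := sin2_cos2 theta). unfold Rsqr in Hcs.
destruct inv_sqrt_2_6 as [H6 H2].
unfold beta1, beta2, beta3, gamma1, gamma2, gamma3.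
replace (2 / sqrt 6) with (2 * (1 / sqrt 6)) by (unfold Rdiv; ring).
set (r := 1 / sqrt 6) in *. set (e := 1 / sqrt 2) in *.
set (C := cos theta) in *. set (S := sin theta) in *.
split.
- transitivity (2 * (e * e) * (C * C) + 6 * (r * r) * (S * S)); [ring|].
  rewrite H6, H2. lra.
- transitivity (2 * (e * e) * (S * S) + 6 * (r * r) * (C * C)); [ring|].
  rewrite H6, H2. lra.
Qed.

(** The products are [- sin (3 theta) / (3 sqrt 6)] and [cos (3 theta) / (3 sqrt 6)]. *)
Lemma coeff_prod_sqr (theta : R) :
  (beta1 theta * beta2 theta * beta3 theta) ^ 2 +
  (gamma1 theta * gamma2 theta * gamma3 theta) ^ 2 = 1 / 54.
Proof.
assert (Hcs := sin2_cos2 theta). unfold Rsqr in Hcs.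
destruct inv_sqrt_2_6 as [H6 H2].
unfold beta1, beta2, beta3, gamma1, gamma2, gamma3.
replace (2 / sqrt 6) with (2 * (1 / sqrt 6)) by (unfold Rdiv; ring).
set (r := 1 / sqrt 6) in *. set (e := 1 / sqrt 2) in *.
set (C := cos theta) in *. set (S := sin theta) in *.
transitivity (4 * (r * r) *
   ((S * S) * ((r * r) * (S * S) - (e * e) * (C * C)) ^ 2
    + (C * C) * ((r * r) * (C * C) - (e * e) * (S * S)) ^ 2)); [ring|].
rewrite H6, H2.
replace (S * S) with (1 - C * C) by lra. field.
Qed.

(** * The Liouville identity and the positivity of a + b v + c w *)

Lemma segment_pos (l q tau : R) :
  0 <= l * q + 1 -> 0 <= tau < 1 -> 0 < l * (tau * q) + 1.
Proof. intros. nra. Qed.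

Lemma cubic_expand (l1 l2 l3 q : R) :
  l1 + l2 + l3 = 0 -> l1 ^ 2 + l2 ^ 2 + l3 ^ 2 = 1 ->
  (l1 * q + 1) * (l2 * q + 1) * (l3 * q + 1) = 1 - q ^ 2 / 2 + l1 * l2 * l3 * q ^ 3.
Proof.
intros H1 H2. assert (l3 = - l1 - l2) by lra. subst l3.
assert (H : l1 ^ 2 + l1 * l2 + l2 ^ 2 = 1 / 2) by nra.
transitivity (1 - q ^ 2 * (l1 ^ 2 + l1 * l2 + l2 ^ 2)
  + l1 * l2 * (- l1 - l2) * q ^ 3); [ring|].
rewrite H. field.
Qed.

(** The identity [f Delta f - |grad f|^2 = 4 |xi|^2 - 4 f^3], in which second derivatives
    and squares of first derivatives are replaced by their values in terms of [v] and [w],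
    and the constants [B] and [C], hence [|xi|^2], are set to zero. *)
Lemma liouville_identity (b c v w : R) :
  b ^ 2 + c ^ 2 = 1 / 216 ->
  let f := 1 / 6 + b * v + c * w in
  f * (b * (- 2 * v - 12 * b * v ^ 2) + c * (- 2 * w - 12 * c * w ^ 2))
  - (b ^ 2 * (4 * (1 - v ^ 2 / 2 - 2 * b * v ^ 3))
     + c ^ 2 * (4 * (1 - w ^ 2 / 2 - 2 * c * w ^ 3)))
  = - 4 * f ^ 3.
Proof.
intros H f. unfold f.
apply Rminus_diag_uniq.
transitivity (- 4 * (b ^ 2 + c ^ 2 - 1 / 216)); [field|].
rewrite H. ring.
Qed.

(** The cubics are [prod (beta_j v + 1)] and [prod (gamma_j w + 1)], expanded. *)
Lemma affine_potential_neq0 (b c v w : R) :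
  b ^ 2 + c ^ 2 = 1 / 216 ->
  0 < b ^ 2 * (1 - v ^ 2 / 2 - 2 * b * v ^ 3) + c ^ 2 * (1 - w ^ 2 / 2 - 2 * c * w ^ 3) ->
  1 / 6 + b * v + c * w <> 0.
Proof.
intros H Hpos Hf. assert (E := liouville_identity b c v w H). cbv zeta in E.
rewrite Hf in E. nra.
Qed.

Lemma affine_potential_pos (l1 l2 l3 m1 m2 m3 b c v w : R) :
  l1 + l2 + l3 = 0 -> l1 ^ 2 + l2 ^ 2 + l3 ^ 2 = 1 ->
  m1 + m2 + m3 = 0 -> m1 ^ 2 + m2 ^ 2 + m3 ^ 2 = 1 ->
  b = - (1 / 2) * l1 * l2 * l3 -> c = - (1 / 2) * m1 * m2 * m3 ->
  b ^ 2 + c ^ 2 = 1 / 216 ->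
  0 <= l1 * v + 1 -> 0 <= l2 * v + 1 -> 0 <= l3 * v + 1 ->
  0 <= m1 * w + 1 -> 0 <= m2 * w + 1 -> 0 <= m3 * w + 1 ->
  0 < b ^ 2 * ((l1 * v + 1) * (l2 * v + 1) * (l3 * v + 1))
      + c ^ 2 * ((m1 * w + 1) * (m2 * w + 1) * (m3 * w + 1)) ->
  0 < 1 / 6 + b * v + c * w.
Proof.
intros Sl Ql Sm Qm Hb Hc Hbc L1 L2 L3 M1 M2 M3 Hpos.
assert (Hneq : forall v w,
  0 < b ^ 2 * ((l1 * v + 1) * (l2 * v + 1) * (l3 * v + 1))
      + c ^ 2 * ((m1 * w + 1) * (m2 * w + 1) * (m3 * w + 1)) ->
  1 / 6 + b * v + c * w <> 0).
{ intros v' w' H. apply affine_potential_neq0; [exact Hbc|].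
  rewrite (cubic_expand l1 l2 l3 v' Sl Ql), (cubic_expand m1 m2 m3 w' Sm Qm) in H.
  replace (2 * b) with (- (l1 * l2 * l3)) by (rewrite Hb; field).
  replace (2 * c) with (- (m1 * m2 * m3)) by (rewrite Hc; field).
  eapply Rlt_le_trans; [exact H | right; ring]. }
set (f := 1 / 6 + b * v + c * w) in *.
destruct (Rtotal_order f 0) as [Hn | [H0 | Hp]]; [exfalso | exfalso | exact Hp].
2: exact (Hneq v w Hpos H0).
(* if f < 0, the affine function vanishes at this tau in [0, 1): it is 1/6 at 0, f at 1 *)
pose (tau := 1 / 6 / (1 / 6 - f)).
assert (Ht : tau * (1 / 6 - f) = 1 / 6) by (unfold tau; field; lra).
assert (Htau : 0 <= tau < 1) by (split; nra).
apply (Hneq (tau * v) (tau * w)).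
- assert (P : 0 < (l1 * (tau * v) + 1) * (l2 * (tau * v) + 1) * (l3 * (tau * v) + 1))
    by (repeat apply Rmult_lt_0_compat; apply segment_pos; assumption).
  assert (Q : 0 < (m1 * (tau * w) + 1) * (m2 * (tau * w) + 1) * (m3 * (tau * w) + 1))
    by (repeat apply Rmult_lt_0_compat; apply segment_pos; assumption).
  assert (B2 := pow2_ge_0 b). assert (C2 := pow2_ge_0 c).
  (* b and c are not both zero *)
  destruct (Rle_lt_or_eq_dec 0 (b ^ 2) B2) as [Hb2 | Hb2]; nra.
- unfold f in Ht. lra.
Qed.

(** * Functions of two variables and Wirtinger derivatives *)

(** [h] has gradient [(h1, h2)] everywhere, in the sense that the chain rule holds along
    every differentiable curve.  This form composes directly with the changes of variable
    used below and specializes to partial derivatives. *)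
Definition has_gradient (h h1 h2 : R -> R -> R) : Prop :=
  forall (sigma tau : R -> R) (x alpha kappa : R),
    is_derive sigma x alpha -> is_derive tau x kappa ->
    is_derive (fun x => h (sigma x) (tau x)) x
      (h1 (sigma x) (tau x) * alpha + h2 (sigma x) (tau x) * kappa).

Lemma has_gradient_scal (k : R) (h h1 h2 : R -> R -> R) :
  has_gradient h h1 h2 ->
  has_gradient (fun s t => k * h s t) (fun s t => k * h1 s t) (fun s t => k * h2 s t).
Proof.
intros H sigma tau x alpha kappa Hs Ht.
replace (_ + _) with
  (k * (h1 (sigma x) (tau x) * alpha + h2 (sigma x) (tau x) * kappa)) by ring.
apply (is_derive_scal (fun x => h (sigma x) (tau x))), H; assumption.
Qed.

Lemma has_gradient_minus_const (k : R) (h h1 h2 : R -> R -> R) :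
  has_gradient h h1 h2 -> has_gradient (fun s t => h s t - k) h1 h2.
Proof.
intros H sigma tau x alpha kappa Hs Ht.
set (l := _ + _). replace l with (l - 0) by ring.
apply (is_derive_minus (K := R_AbsRing) (V := R_NormedModule)
  (fun x => h (sigma x) (tau x)) (fun _ => k)).
- apply H; assumption.
- apply (is_derive_const (K := R_AbsRing) (V := R_NormedModule)).
Qed.

Lemma has_gradient_s (h h1 h2 : R -> R -> R) (s t : R) :
  has_gradient h h1 h2 -> is_derive (fun s => h s t) s (h1 s t).
Proof.
intros H.
replace (h1 s t) with (h1 s t * 1 + h2 s t * 0) by ring.
apply (H (fun s => s) (fun _ => t)); auto_derive; trivial; ring.
Qed.

Lemma is_derive_half_lin_comb (f g : R -> R) (u e z lf lg : R) :
  is_derive f z lf -> is_derive g z lg ->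
  is_derive (fun z => (f z * u + g z * e) / 2) z ((lf * u + lg * e) / 2).
Proof.
intros Hf Hg. auto_derive.
- repeat split; eexists; eassumption.
- rewrite (Derive_app _ _ _ Hf), (Derive_app _ _ _ Hg). field.
Qed.

(** For [H (p) = h (mu p)] with [mu] complex, [d^2 H / dz dzbar] is [|mu|^2 / 4] times the
    Laplacian of [h] at [mu p].  The second hypothesis and the third share [h12], which is
    the symmetry of the mixed second derivatives. *)
Lemma is_wirtinger_mixed_rotated (h h1 h2 h11 h12 h22 : R -> R -> R) (mu : C)
    (F L : C -> C) :
  has_gradient h h1 h2 -> has_gradient h1 h11 h12 -> has_gradient h2 h12 h22 ->
  (forall p, F p = RtoC (h (Re (mu * p)%C) (Im (mu * p)%C))) ->
  (forall p, L p = RtoC (Cmod mu ^ 2 *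
     (h11 (Re (mu * p)%C) (Im (mu * p)%C) + h22 (Re (mu * p)%C) (Im (mu * p)%C)) / 4)) ->
  is_wirtinger_mixed F L.
Proof.
intros H H1 H2 HF HL.
destruct mu as [m n].
pose (sg x y := m * x - n * y). pose (tu x y := m * y + n * x).
assert (Sx : forall x y, is_derive (fun x => sg x y) x m)
  by (intros; unfold sg; auto_derive; trivial; ring).
assert (Tx : forall x y, is_derive (fun x => tu x y) x n)
  by (intros; unfold tu; auto_derive; trivial; ring).
assert (Sy : forall x y, is_derive (fun y => sg x y) y (- n))
  by (intros; unfold sg; auto_derive; trivial; ring).
assert (Ty : forall x y, is_derive (fun y => tu x y) y m)
  by (intros; unfold tu; auto_derive; trivial; ring).
assert (HF' : forall x y, F (x, y) = (h (sg x y) (tu x y), 0))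
  by (intros; rewrite HF; reflexivity).
assert (HL' : forall x y, L (x, y) = RtoC ((m ^ 2 + n ^ 2) *
    (h11 (sg x y) (tu x y) + h22 (sg x y) (tu x y)) / 4)).
{ intros. rewrite HL, Cmod2_alt. reflexivity. }
(* the real and imaginary parts of dH/dzbar = (H_x + i H_y) / 2 *)
pose (Gx x y := (h1 (sg x y) (tu x y) * m + h2 (sg x y) (tu x y) * n) / 2).
pose (Gy x y := (h1 (sg x y) (tu x y) * (- n) + h2 (sg x y) (tu x y) * m) / 2).
exists (fun p => (Gx (Re p) (Im p), Gy (Re p) (Im p))).
intros [x y]. simpl Re; simpl Im. split.
- exists (2 * Gx x y, 0), (2 * Gy x y, 0). split; [|split].
  + unfold is_partial_re; simpl.
    apply (is_derive_ext (V := C_R_NormedModule) (fun x => (h (sg x y) (tu x y), 0))).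
    { intros t. symmetry. apply HF'. }
    apply is_derive_RC_pair; [|apply (is_derive_const (K := R_AbsRing) (V := R_NormedModule))].
    replace (2 * Gx x y) with (h1 (sg x y) (tu x y) * m + h2 (sg x y) (tu x y) * n)
      by (unfold Gx; field).
    apply (H (fun x => sg x y) (fun x => tu x y)); auto.
  + unfold is_partial_im; simpl.
    apply (is_derive_ext (V := C_R_NormedModule) (fun y => (h (sg x y) (tu x y), 0))).
    { intros t. symmetry. apply HF'. }
    apply is_derive_RC_pair; [|apply (is_derive_const (K := R_AbsRing) (V := R_NormedModule))].
    replace (2 * Gy x y) with (h1 (sg x y) (tu x y) * (- n) + h2 (sg x y) (tu x y) * m)
      by (unfold Gy; field).
    apply (H (fun y => sg x y) (fun y => tu x y)); auto.
  + unfold Cdiv, Cinv, Cmult, Cplus, Ci, RtoC; simpl. apply f_equal2; field.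
- (* one formula for both partial derivatives of both components of G *)
  assert (DG : forall (sigma tau : R -> R) (a k u e z : R), is_derive sigma z a ->
     is_derive tau z k ->
     is_derive (fun z => (h1 (sigma z) (tau z) * u + h2 (sigma z) (tau z) * e) / 2) z
       (((h11 (sigma z) (tau z) * a + h12 (sigma z) (tau z) * k) * u
        + (h12 (sigma z) (tau z) * a + h22 (sigma z) (tau z) * k) * e) / 2)).
  { intros sigma tau a k u e z Hs Ht.
    exact (is_derive_half_lin_comb _ _ u e z _ _ (H1 _ _ _ _ _ Hs Ht) (H2 _ _ _ _ _ Hs Ht)). }
  set (s0 := sg x y) in *. set (t0 := tu x y) in *.
  exists (((h11 s0 t0 * m + h12 s0 t0 * n) * m + (h12 s0 t0 * m + h22 s0 t0 * n) * n) / 2,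
          ((h11 s0 t0 * m + h12 s0 t0 * n) * (- n) + (h12 s0 t0 * m + h22 s0 t0 * n) * m) / 2).
  exists (((h11 s0 t0 * (- n) + h12 s0 t0 * m) * m + (h12 s0 t0 * (- n) + h22 s0 t0 * m) * n) / 2,
          ((h11 s0 t0 * (- n) + h12 s0 t0 * m) * (- n) + (h12 s0 t0 * (- n) + h22 s0 t0 * m) * m) / 2).
  split; [|split].
  + unfold is_partial_re; simpl. apply is_derive_RC_pair; unfold Gx, Gy;
      apply (DG (fun x => sg x y) (fun x => tu x y)); auto.
  + unfold is_partial_im; simpl. apply is_derive_RC_pair; unfold Gx, Gy;
      apply (DG (fun y => sg x y) (fun y => tu x y)); auto.
  + rewrite HL'. fold s0 t0.
    unfold Cdiv, Cinv, Cmult, Cminus, Cplus, Copp, Ci, RtoC; simpl. apply f_equal2; field.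
Qed.

(** Gradient and Hessian of [ln (a + b v(s) + c w(t))]. *)
Lemma log_affine_gradient (v v1 v2 w w1 w2 : R -> R) (a b c : R) :
  (forall s, is_derive v s (v1 s)) -> (forall s, is_derive v1 s (v2 s)) ->
  (forall t, is_derive w t (w1 t)) -> (forall t, is_derive w1 t (w2 t)) ->
  (forall s t, 0 < a + b * v s + c * w t) ->
  let f s t := a + b * v s + c * w t in
  let g1 s t := b * v1 s / f s t in
  let g2 s t := c * w1 t / f s t in
  let g12 s t := - (b * v1 s * (c * w1 t)) / f s t ^ 2 in
  has_gradient (fun s t => ln (f s t)) g1 g2 /\
  has_gradient g1 (fun s t => (b * v2 s * f s t - (b * v1 s) ^ 2) / f s t ^ 2) g12 /\
  has_gradient g2 g12 (fun s t => (c * w2 t * f s t - (c * w1 t) ^ 2) / f s t ^ 2).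
Proof.
intros Hv Hv1 Hw Hw1 Hf f g1 g2 g12.
unfold g1, g2, g12, f.
split; [|split]; intros sigma tau x al ka Hs Ht; assert (P := Hf (sigma x) (tau x));
  auto_derive;
  try (repeat split; first [eexists; eauto; fail | assumption | lra]);
  rewrite (Derive_app _ _ _ Hs), (Derive_app _ _ _ Ht), (Derive_app _ _ _ (Hv (sigma x))),
    (Derive_app _ _ _ (Hw (tau x)));
  try rewrite (Derive_app _ _ _ (Hv1 (sigma x)));
  try rewrite (Derive_app _ _ _ (Hw1 (tau x)));
  field; lra.
Qed.

Lemma has_gradient_twice_derivable_s (h h1 h2 h11 h12 : R -> R -> R) (k : R -> R) (t : R) :
  has_gradient h h1 h2 -> has_gradient h1 h11 h12 -> (forall s, k s = h s t) ->
  twice_derivable k /\ forall s, Derive_n k 2 s = h11 s t.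
Proof.
intros H H1 Hk.
assert (D : forall s, is_derive k s (h1 s t)).
{ intros s. apply is_derive_ext with (fun s => h s t); [auto|].
  apply (has_gradient_s _ _ _ _ _ H). }
assert (D2 : forall s, is_derive (Derive k) s (h11 s t)).
{ intros s. apply is_derive_ext with (fun s => h1 s t).
  - intros z. symmetry. apply is_derive_unique, D.
  - apply (has_gradient_s _ _ _ _ _ H1). }
split.
- intros s. split; eexists; [apply D | apply D2].
- intros s. simpl. apply is_derive_unique, D2.
Qed.

Lemma has_gradient_swap (h h1 h2 : R -> R -> R) :
  has_gradient h h1 h2 ->
  has_gradient (fun s t => h t s) (fun s t => h2 t s) (fun s t => h1 t s).
Proof.
intros H sigma tau x al ka Hs Ht. rewrite Rplus_comm. apply H; assumption.
Qed.

Lemma has_gradient_twice_derivable_t (h h1 h2 h12 h22 : R -> R -> R) (k : R -> R) (s : R) :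
  has_gradient h h1 h2 -> has_gradient h2 h12 h22 -> (forall t, k t = h s t) ->
  twice_derivable k /\ forall t, Derive_n k 2 t = h22 s t.
Proof.
intros H H2 Hk.
apply (has_gradient_twice_derivable_s (fun s t => h t s) (fun s t => h2 t s)
  (fun s t => h1 t s) (fun s t => h22 t s) (fun s t => h12 t s) k s);
  [apply has_gradient_swap, H | apply has_gradient_swap, H2 | exact Hk].
Qed.

(** * Powers, holomorphic scaling and residues modulo 3 *)

Lemma Cmult_l_ex_derive (zeta p : C) :
  @ex_derive C_AbsRing (AbsRing_NormedModule C_AbsRing) (fun p : C => (zeta * p)%C) p.
Proof.
eexists.
exact (is_derive_mult (K := C_AbsRing) (fun _ => zeta) (fun p => p) p _ _
  (is_derive_const (K := C_AbsRing) (V := AbsRing_NormedModule C_AbsRing) zeta p)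
  (is_derive_id (K := C_AbsRing) p) Cmult_comm).
Qed.

Lemma Rpower_two_thirds_cube (x : R) : 0 < x -> Rpower x (2 / 3) ^ 3 = x ^ 2.
Proof.
intros Hx. rewrite <- (Rpower_pow 3) by apply exp_pos.
rewrite Rpower_mult, <- (Rpower_pow 2) by exact Hx.
f_equal. simpl. field.
Qed.

Lemma Rpower_cube_two_thirds (x : R) : 0 < x -> Rpower (x ^ 3) (2 / 3) = x ^ 2.
Proof.
intros Hx. rewrite <- (Rpower_pow 3), <- (Rpower_pow 2) by exact Hx.
rewrite Rpower_mult. f_equal. simpl. field.
Qed.

Lemma Z_residue_mod_3 (k : Z) :
  exists j, (k = 3 * j \/ k = 3 * j + 1 \/ k = 3 * j - 1)%Z.
Proof.
exists ((k + 1) / 3)%Z.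
assert (D := Z.div_mod (k + 1) 3 ltac:(lia)).
assert (M := Z.mod_pos_bound (k + 1) 3 ltac:(lia)). lia.
Qed.

(** * The Toda lattice equations *)

Theorem proposition6p2
  (theta0 : R) (htheta0 : 0 <= theta0 < 2 * PI)
  (y1 y2 y3 : R -> C) (v : R -> R)
  (z1 z2 z3 : R -> C) (w : R -> R)
  (hy : triple_system (beta1 theta0) (beta2 theta0) (beta3 theta0) y1 y2 y3 v)
  (hz : triple_system (gamma1 theta0) (gamma2 theta0) (gamma3 theta0) z1 z2 z3 w)
  (B0 C0 : R) (hBrange : -1 <= B0 <= 1) (hCrange : -1 <= C0 <= 1)
  (hB : forall s : R, Im (y1 s * y2 s * y3 s)%C = B0)
  (hC : forall t : R, Im (z1 t * z2 t * z3 t)%C = C0)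
  (a b c : R)
  (ha : a = 1 / 6)
  (hb : b = - (1 / 2) * beta1 theta0 * beta2 theta0 * beta3 theta0)
  (hc : c = - (1 / 2) * gamma1 theta0 * gamma2 theta0 * gamma3 theta0)
  (xi : C) (hxi : xi = (RtoC (c * C0) + Ci * RtoC (b * B0))%C)
  (hxi0 : xi <> RtoC 0)
  (chi : Z -> C -> R)
  (hchi2 : forall (k : Z) (s t : R),
     chi (3 * k - 1)%Z (s, t) = Rpower (Cmod xi) (2 / 3) * / (a + b * v s + c * w t))
  (hchi0 : forall (k : Z) (s t : R), chi (3 * k)%Z (s, t) = 1)
  (hchi1 : forall (k : Z) (s t : R),
     chi (3 * k + 1)%Z (s, t) = Rpower (Cmod xi) (- (2 / 3)) * (a + b * v s + c * w t)) :
  (forall (k : Z) (p : C), 0 < chi k p) /\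
  (forall zeta : C, (zeta ^ 3)%C = xi ->
     toda_lattice_wrt (fun p : C => (zeta * p)%C) 3 chi) /\
  (forall s t : R, chi 0%Z (s, t) * chi 1%Z (s, t) * chi 2%Z (s, t) = 1) /\
  (forall (k : Z) (s t : R), chi (k + 3)%Z (s, t) = chi k (s, t)) /\
  (forall (k : Z) (t : R), twice_derivable (fun s : R => ln (chi k (s, t)))) /\
  (forall (k : Z) (s : R), twice_derivable (fun t : R => ln (chi k (s, t)))) /\
  (forall (k : Z) (s t : R),
     1 / (4 * Rpower (Cmod xi) (2 / 3)) *
       (Derive_n (fun s' : R => ln (chi k (s', t))) 2 s +
        Derive_n (fun t' : R => ln (chi k (s, t'))) 2 t)
     = chi (k + 1)%Z (s, t) * / chi k (s, t) - chi k (s, t) * / chi (k - 1)%Z (s, t)).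
Proof.
destruct (coeff_sum theta0) as [Sb Sg].
destruct (coeff_sum_sqr theta0) as [Qb Qg].
destruct (triple_system_ode _ _ _ _ _ _ _ _ Sb Qb hy hB) as [v1 Hv].
destruct (triple_system_ode _ _ _ _ _ _ _ _ Sg Qg hz hC) as [w1 Hw].
assert (Hpb : beta1 theta0 * beta2 theta0 * beta3 theta0 = - 2 * b) by (rewrite hb; field).
assert (Hpc : gamma1 theta0 * gamma2 theta0 * gamma3 theta0 = - 2 * c) by (rewrite hc; field).
assert (Hbc : b ^ 2 + c ^ 2 = 1 / 216).
{ assert (E := coeff_prod_sqr theta0). rewrite Hpb, Hpc in E. lra. }
assert (Hxi2 : Cmod xi ^ 2 = (b * B0) ^ 2 + (c * C0) ^ 2).
{ rewrite Cmod2_alt, hxi. simpl. ring. }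
assert (Hxipos : 0 < Cmod xi) by (apply Cmod_gt_0; exact hxi0).
pose (f s t := a + b * v s + c * w t).
assert (Hf : forall s t, 0 < a + b * v s + c * w t).
{ intros s t. rewrite ha.
  destruct (hy s) as (_ & _ & _ & Y1 & Y2 & Y3).
  destruct (hz t) as (_ & _ & _ & Z1 & Z2 & Z3).
  destruct (Hv s) as (_ & _ & V). destruct (Hw t) as (_ & _ & W).
  refine (affine_potential_pos _ _ _ _ _ _ b c (v s) (w t) Sb Qb Sg Qg hb hc Hbc
    _ _ _ _ _ _ _).
  1-3: rewrite <- ?Y1, <- ?Y2, <- ?Y3; apply pow2_ge_0.
  1-3: rewrite <- ?Z1, <- ?Z2, <- ?Z3; apply pow2_ge_0.
  (* v1^2 >= 0 says that the product of the beta_j v + 1 is at least B0^2 *)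
  assert (Xp : 0 < Cmod xi ^ 2) by (apply pow_lt, Hxipos).
  assert (V0 := pow2_ge_0 (v1 s)). assert (W0 := pow2_ge_0 (w1 t)).
  rewrite V in V0. rewrite W in W0.
  apply Rlt_le_trans with (1 := Xp). rewrite Hxi2, !Rpow_mult_distr.
  apply Rplus_le_compat; apply Rmult_le_compat_l; try apply pow2_ge_0; lra. }
pose (rho := Rpower (Cmod xi) (2 / 3)).
assert (Hrho : 0 < rho) by apply exp_pos.
assert (Hrho3 : rho ^ 3 = Cmod xi ^ 2) by (apply Rpower_two_thirds_cube, Hxipos).
(* e is 0, 1, -1 according as k is 0, 1, 2 modulo 3 *)
assert (Hchi : forall k, exists e, forall s t,
  0 < chi k (s, t) /\ ln (chi k (s, t)) = e * (ln (f s t) - ln rho) /\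
  chi (k + 1)%Z (s, t) * / chi k (s, t) - chi k (s, t) * / chi (k - 1)%Z (s, t)
  = e * (rho ^ 2 / f s t ^ 2 - f s t / rho)).
{ intros k.
  assert (C2 : forall j s t, chi (3 * j - 1)%Z (s, t) = rho * / f s t)
    by (intros; apply hchi2).
  assert (C1 : forall j s t, chi (3 * j + 1)%Z (s, t) = / rho * f s t).
  { intros. rewrite hchi1, Rpower_Ropp. reflexivity. }
  destruct (Z_residue_mod_3 k) as [j [-> | [-> | ->]]].
  - exists 0. intros s t. assert (P := Hf s t). fold (f s t) in P.
    rewrite C2, C1, hchi0, ln_1.
    split; [lra|]. split; [ring | field; lra].
  - exists 1. intros s t. assert (P := Hf s t). fold (f s t) in P.
    replace (3 * j + 1 + 1)%Z with (3 * (j + 1) - 1)%Z by lia.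
    replace (3 * j + 1 - 1)%Z with (3 * j)%Z by lia.
    rewrite C2, C1, hchi0.
    assert (Q := Rinv_0_lt_compat _ Hrho).
    split; [apply Rmult_lt_0_compat; assumption|]. split.
    + rewrite ln_mult, ln_Rinv by assumption. ring.
    + field; lra.
  - exists (-1). intros s t. assert (P := Hf s t). fold (f s t) in P.
    replace (3 * j - 1 + 1)%Z with (3 * j)%Z by lia.
    replace (3 * j - 1 - 1)%Z with (3 * (j - 1) + 1)%Z by lia.
    rewrite C2, C1, hchi0.
    assert (Q := Rinv_0_lt_compat _ P).
    split; [apply Rmult_lt_0_compat; assumption|]. split.
    + rewrite ln_mult, ln_Rinv by assumption. ring.
    + field; lra. }
destruct (log_affine_gradient v v1 _ w w1 _ a b c
  (fun s => proj1 (Hv s)) (fun s => proj1 (proj2 (Hv s)))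
  (fun t => proj1 (Hw t)) (fun t => proj1 (proj2 (Hw t))) Hf) as (G0 & G1 & G2).
match type of G1 with has_gradient ?x1 ?x11 ?x12 =>
  set (g1 := x1) in *; set (g11 := x11) in *; set (g12 := x12) in * end.
match type of G2 with has_gradient ?x2 _ ?x22 =>
  set (g2 := x2) in *; set (g22 := x22) in * end.
assert (Hlap : forall s t, g11 s t + g22 s t = 4 * rho * (rho ^ 2 / f s t ^ 2 - f s t / rho)).
{ intros s t. assert (P := Hf s t). fold (f s t) in P.
  assert (E := liouville_identity b c (v s) (w t) Hbc). cbv zeta in E.
  rewrite <- ha in E. fold (f s t) in E.
  destruct (Hv s) as (_ & _ & V). destruct (Hw t) as (_ & _ & W).
  rewrite (cubic_expand _ _ _ _ Sb Qb), Hpb in V.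
  rewrite (cubic_expand _ _ _ _ Sg Qg), Hpc in W.
  transitivity ((f s t * (b * (- 2 * v s - 12 * b * v s ^ 2)
      + c * (- 2 * w t - 12 * c * w t ^ 2))
      - (b ^ 2 * v1 s ^ 2 + c ^ 2 * w1 t ^ 2)) / f s t ^ 2).
  { unfold g11, g22. rewrite Hpb, Hpc. fold (f s t). field. lra. }
  transitivity ((4 * rho ^ 3 - 4 * f s t ^ 3) / f s t ^ 2); [|field; lra].
  f_equal. rewrite V, W, Hrho3, Hxi2. lra. }
assert (Hpos : forall k p, 0 < chi k p).
{ intros k [s t]. destruct (Hchi k) as [e He]. apply He. }
assert (Hper : forall k s t, chi (k + 3)%Z (s, t) = chi k (s, t)).
{ intros k s t.
  destruct (Z_residue_mod_3 k) as [j [-> | [-> | ->]]].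
  - replace (3 * j + 3)%Z with (3 * (j + 1))%Z by lia. rewrite !hchi0. reflexivity.
  - replace (3 * j + 1 + 3)%Z with (3 * (j + 1) + 1)%Z by lia. rewrite !hchi1. reflexivity.
  - replace (3 * j - 1 + 3)%Z with (3 * (j + 1) - 1)%Z by lia. rewrite !hchi2. reflexivity. }
assert (Hprod : forall s t, chi 0%Z (s, t) * chi 1%Z (s, t) * chi 2%Z (s, t) = 1).
{ intros s t. assert (P := Hf s t).
  assert (E0 := hchi0 0%Z s t). assert (E1 := hchi1 0%Z s t). assert (E2 := hchi2 1%Z s t).
  simpl Z.mul in E0, E1, E2. simpl Z.add in E1. simpl Z.sub in E2.
  rewrite E0, E1, E2, Rpower_Ropp. fold rho. field. lra. }
assert (Hgrad : forall k, exists e h,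
  has_gradient h (fun s t => e * g1 s t) (fun s t => e * g2 s t) /\
  (forall s t, ln (chi k (s, t)) = h s t) /\
  (forall s t, chi (k + 1)%Z (s, t) * / chi k (s, t) - chi k (s, t) * / chi (k - 1)%Z (s, t)
     = (e * g11 s t + e * g22 s t) / (4 * rho))).
{ intros k. destruct (Hchi k) as [e He].
  exists e, (fun s t => e * (ln (f s t) - ln rho)). split; [|split].
  - apply has_gradient_scal, has_gradient_minus_const, G0.
  - intros s t. apply He.
  - intros s t. rewrite <- Rmult_plus_distr_l, Hlap.
    destruct (He s t) as (_ & _ & ->). assert (P := Hf s t). fold (f s t) in P. field. lra. }
split; [exact Hpos|]. split; [|split; [exact Hprod | split; [exact Hper |]]].
- intros zeta Hz. split; [intros p; apply Cmult_l_ex_derive|].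
  assert (Hz0 : zeta <> RtoC 0).
  { intros E. apply hxi0. rewrite <- Hz, E. simpl. ring. }
  exists (fun p => (/ zeta * p)%C).
  split; [intros p; field; exact Hz0|]. split; [intros p; field; exact Hz0|].
  assert (Hrhoz : rho = Cmod zeta ^ 2).
  { unfold rho. rewrite <- Hz, Cmod_pow.
    apply Rpower_cube_two_thirds, Cmod_gt_0, Hz0. }
  split; [intros; apply Hpos|]. split; [|split].
  + intros k p. destruct (/ zeta * p)%C as [s t]. apply Hper.
  + intros p. simpl. destruct (/ zeta * p)%C as [s t].
    rewrite Rmult_1_r, <- Rmult_assoc. apply Hprod.
  + intros k. destruct (Hgrad k) as (e & h & Hh & Hln & Htoda).
    refine (is_wirtinger_mixed_rotated h _ _ _ _ _ (/ zeta)%C _ _ Hh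
      (has_gradient_scal e _ _ _ G1) (has_gradient_scal e _ _ _ G2) _ _); intros p.
    * rewrite <- Hln. destruct (/ zeta * p)%C. reflexivity.
    * cbv beta. destruct (/ zeta * p)%C as [s t]. rewrite Htoda. simpl Re; simpl Im.
      rewrite Cmod_inv, pow_inv, <- Hrhoz by exact Hz0. apply f_equal. field. lra.
- split; [|split].
  + intros k t. destruct (Hgrad k) as (e & h & Hh & Hln & _).
    apply (has_gradient_twice_derivable_s h _ _ _ _ _ t Hh (has_gradient_scal e _ _ _ G1)).
    intros s. apply Hln.
  + intros k s. destruct (Hgrad k) as (e & h & Hh & Hln & _).
    apply (has_gradient_twice_derivable_t h _ _ _ _ _ s Hh (has_gradient_scal e _ _ _ G2)).
    intros t. apply Hln.
  + intros k s t. destruct (Hgrad k) as (e & h & Hh & Hln & Htoda).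
    fold rho. rewrite Htoda.
    rewrite (proj2 (has_gradient_twice_derivable_s h _ _ _ _ _ t Hh
      (has_gradient_scal e _ _ _ G1) (fun s => Hln s t)) s).
    rewrite (proj2 (has_gradient_twice_derivable_t h _ _ _ _ _ s Hh
      (has_gradient_scal e _ _ _ G2) (Hln s)) t).
    field. lra.
Qed.
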